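(* Let $p\ge3$ be an integer. To any vector $U=(U_i)_{1\le i\le p}\in\mathbb R^p$ associate the set of probability measures $$\mathcal M_p(U):=\left\{\sum_{i=1}^pc_i\delta_{U_i}\ :\ (c_i)_{1\le i\le p}\in(0,+\infty)^p,\ \sum_{i=1}^pc_i=1\right\}.$$ Let $\lambda_p$ denote the Lebesgue measure on $\mathbb R^p$. Then for all $b>\frac1{p-2}$, $$\lambda_p\left(\left\{U\in\mathbb R^p\ :\ \mathcal M_p(U)\not\subset\mathcal C(1,2b)\right\}\right)=0.$$
   Context: For $\beta>0$, $\mathcal C(1,\beta)$ is the class of probability measures $\mu$ on $\mathbb R$ (weak Cramer condition) whose characteristic function $\phi(t)=\int e^{itx}\,d\mu(x)$ satisfies: there exist constants $C>0$ and $R>0$ such that $|\phi(t)|\le1-\frac{C}{|t|^\beta}$ for all $|t|>R$. *)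

(* Defs.v *)
From HB Require Import structures.
From mathcomp Require Import all_boot all_order all_algebra.
From mathcomp Require Import all_classical all_reals all_analysis.
From mathcomp Require Import complex.

Set Implicit Arguments.
Unset Strict Implicit.
Unset Printing Implicit Defensive.

Import Order.TTheory GRing.Theory Num.Theory.
Import numFieldNormedType.Exports.

Local Open Scope classical_set_scope.
Local Open Scope ring_scope.
Local Open Scope complex_scope.

(* R^n is n.-tuple (measurableTypeR R), whose sigma-algebra is generated by
   the coordinates, i.e. the Borel sigma-algebra; lambda_n is built by
   iterated products, R^n.+1 being identified with R * R^n. *)
Section lebesgue_measure_tuple.
Context {R : realType}.
Local Notation T := (measurableTypeR R).

Definition cons_pair n (x : T * n.-tuple T) : n.+1.-tuple T :=
  [the n.+1.-tuple T of x.1 :: x.2].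

Lemma measurable_cons_pair n : measurable_fun setT (@cons_pair n).
Proof. exact: measurable_cons. Qed.

Section step.
Context (n : nat) (m : {sigma_finite_measure set (n.-tuple T) -> \bar R}).

Definition lebesgue_cons : set (n.+1.-tuple T) -> \bar R :=
  pushforward (@lebesgue_measure R \x m)%E (@cons_pair n).

Let lebesgue_cons0 : lebesgue_cons set0 = 0%E.
Proof. by rewrite /lebesgue_cons /pushforward preimage_set0 measure0. Qed.

Let lebesgue_cons_ge0 A : (0 <= lebesgue_cons A)%E.
Proof. by apply: integral_ge0 => x _; exact: measure_ge0. Qed.

Let lebesgue_cons_sigma_additive : semi_sigma_additive lebesgue_cons.
Proof.
move=> F mF tF mUF; rewrite /lebesgue_cons /pushforward preimage_bigcup.
have mcF A : measurable A -> measurable (@cons_pair n @^-1` A).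
  by move=> mA; rewrite -[X in measurable X]setTI; exact: measurable_cons_pair.
apply: measure_semi_sigma_additive.
- by move=> k; exact: mcF.
- apply/trivIsetP => /= i j _ _ ij; rewrite -preimage_setI.
  by move/trivIsetP : tF => /(_ _ _ _ _ ij) ->//; rewrite preimage_set0.
- by rewrite -preimage_bigcup; exact: mcF.
Qed.

HB.instance Definition _ := isMeasure.Build _ _ _ lebesgue_cons
  lebesgue_cons0 lebesgue_cons_ge0 lebesgue_cons_sigma_additive.

Let lebesgue_cons_sigma_finite : sigma_finite setT lebesgue_cons.
Proof.
have /sigma_finiteP[F [TF ndF Foo]] := sigma_finiteT (@lebesgue_measure R).
have /sigma_finiteP[G [TG ndG Goo]] := sigma_finiteT m.
pose g (t : n.+1.-tuple T) := (thead t, [tuple of behead t]).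
have mg : measurable_fun setT g.
  apply/measurable_fun_pairP; split; first exact: measurable_tnth.
  exact: measurable_behead.
have gK : cancel (@cons_pair n) g.
  by case=> x t; rewrite /g /cons_pair theadE; congr pair; apply/val_inj.
exists (fun k => g @^-1` (F k `*` G k)).
  rewrite -preimage_bigcup -[LHS](preimage_setT g); congr (_ @^-1` _).
  rewrite -setXTT TF TG predeqE => -[x y]; split => [[/= [k _ Fkx] [l _ Gly]]|].
    exists (maxn k l) => //; split.
    - by move: x Fkx; exact/subsetPset/ndF/leq_maxl.
    - by move: y Gly; exact/subsetPset/ndG/leq_maxr.
  by move=> [k _ []/= ? ?]; split; exists k.
move=> k; have [mF Fk] := Foo k; have [mG Gk] := Goo k; split.
  by rewrite -[X in measurable X]setTI; apply: mg => //; exact: measurableX.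
rewrite /lebesgue_cons /pushforward -comp_preimage.
rewrite (_ : g \o _ = id); last by apply/funext => x /=; rewrite gK.
rewrite preimage_id product_measure1E// lte_mul_pinfty//.
by rewrite ge0_fin_numE.
Qed.

HB.instance Definition _ := Measure_isSigmaFinite.Build _ _ _ lebesgue_cons
  lebesgue_cons_sigma_finite.

End step.

Fixpoint lebesgue_measure_tuple (n : nat) :
    {sigma_finite_measure set (n.-tuple T) -> \bar R} :=
  match n with
  | 0 => [the {sigma_finite_measure set (0.-tuple T) -> \bar R} of
           \d_([tuple] : 0.-tuple T)]
  | m.+1 => [the {sigma_finite_measure set (m.+1.-tuple T) -> \bar R} of
           lebesgue_cons (lebesgue_measure_tuple m)]
  end.

Lemma lebesgue_measure_tuple_box n (A : 'I_n -> set T) :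
  (forall i, measurable (A i)) ->
  lebesgue_measure_tuple n [set x | forall i, A i (tnth x i)] =
  (\prod_(i < n) lebesgue_measure (A i))%E.
Proof.
elim: n A => [|n IHn] A mA.
  rewrite big_ord0 /= diracE mem_set// => -[].
  by [].
rewrite big_ord_recl -IHn//= /lebesgue_cons /pushforward.
rewrite -product_measure1E//.
  congr (_ _); apply/seteqP; split => [[x t]|[x t]] /=.
    move=> Axt; split; first by have := Axt ord0.
    by move=> i; have := Axt (lift ord0 i); rewrite tnthS.
  move=> [Ax At] i; case: (unliftP ord0 i) => [j ->|->//].
  by rewrite tnthS; exact: At.
rewrite [X in measurable X](_ : _ = \bigcap_(i in [set: 'I_n])
    ((fun x : n.-tuple T => tnth x i) @^-1` A (lift ord0 i))); last first.
  by apply/seteqP; split => [x Ax i _|x Ax i]; [exact: Ax|exact: (Ax i I)].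
apply: fin_bigcap_measurable => // i _.
by rewrite -[X in measurable X]setTI; exact: measurable_tnth.
Qed.

End lebesgue_measure_tuple.

Section weak_cramer.
Context {R : realType}.

Definition expi (x : R) : R[i] := cos x +i* sin x.

Definition complex_integral (mu : probability (measurableTypeR R) R)
    (f : R -> R[i]) : R[i] :=
  (\int[mu]_x complex.Re (f x)) +i* (\int[mu]_x complex.Im (f x)).

Definition characteristic_function (mu : probability (measurableTypeR R) R)
    (t : R) : R[i] :=
  complex_integral mu (fun x => expi (t * x)).

(* The class C(1, beta). The modulus and the inequality are those of R[i];
   for u v : R, u%:C <= v%:C in R[i] iff u <= v. *)
Definition weak_cramer (beta : R) : set (probability (measurableTypeR R) R) :=
  [set mu : probability (measurableTypeR R) R | exists C T : R, [/\ 0 < C, 0 < T &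
    forall t : R, T < `|t| ->
      `|characteristic_function mu t| <= (1 - C / `|t| `^ beta)%:C]].

(* Measures are total on sets, with irrelevant values outside the measurable
   sets: equality of measures is equality on measurable sets. *)
Definition discrete_measures (p : nat) (U : p.-tuple (measurableTypeR R)) :
    set (probability (measurableTypeR R) R) :=
  [set mu : probability (measurableTypeR R) R | exists c : 'I_p -> R, [/\ forall i, 0 < c i,
    \sum_(i < p) c i = 1 &
    forall A : set (measurableTypeR R), measurable A ->
      mu A = (\sum_(i < p) (c i)%:E * \d_(tnth U i) A)%E]].

End weak_cramer.

(* Main.v *)
Require Import Defs.
From mathcomp Require Import all_boot all_order all_algebra.
From mathcomp Require Import all_classical all_reals all_analysis.
From mathcomp Require Import measurable_realfun.
From mathcomp Require Import complex.
From mathcomp Require Import ring lra zify.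

Set Implicit Arguments.
Unset Strict Implicit.
Unset Printing Implicit Defensive.

Import Order.TTheory GRing.Theory Num.Theory.
Import numFieldNormedType.Exports.

Local Open Scope classical_set_scope.
Local Open Scope ring_scope.

(** Write U_0, ..., U_k for the points (k = p - 1) and phi for the
    characteristic function of a measure with atoms U_i and weights c_i.
    Expanding the square of the modulus gives
      1 - |phi(t)|^2 = sum_(i,j) c_i c_j (1 - cos (t (U_i - U_j))),
    and each term with j = 0 is 2 c_i c_0 sin^2 (t/2 (U_i - U_0)).  So |phi|
    can be close to 1 at 2t only if t is a near resonance of U: all the numbers
    |sin (t (U_i - U_0))|, 1 <= i <= k, are small
    ([norm_characteristic_function_discrete]).  It suffices to show that, for
    almost every U, for all large t at least one of them exceeds a constant
    multiple of t^-b: the weak Cramer bound with exponent 2b follows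
    ([weak_cramer_of_nonresonant]).

    This is a Borel-Cantelli argument.  Confine U to a cube [-M, M]^(k+1), fix
    a dyadic block 2^n <= t < 2^(n+1) and let N be about 2^(nb).  Since the
    functions t |-> sin (t (U_i - U_0)) are 2M-Lipschitz, a resonance of
    quality 1/N somewhere in the block forces one of quality (1 + 2M)/N on the
    grid of step 1/N, which has 2^n N points ([grid_resonance_cover]).  At a
    fixed t >= 1 and for a fixed U_0, the condition on each of the k other
    coordinates defines a set of measure O(1/N), because a 1/N-neighbourhood of
    the zeros of sin has density O(1/N) ([lebesgue_near_resonance1]); these k
    conditions are independent given U_0, so a grid point contributes
    O(N^-k) ([lebesgue_near_resonance]).  The whole block contributes
    O(2^n N^(1-k)) = O((2^(1 - b (k-1)))^n), a convergent geometric series as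
    soon as b (k - 1) = b (p - 2) > 1 ([lebesgue_grid_resonance]).  Hence
    almost every U in the cube lies in finitely many of these bad sets, and the
    cubes with integer M exhaust the space. *)

(** * Small values of the sine *)

Lemma sin_mvt (R : realType) (y : R) : 0 < y ->
  exists2 z, 0 < z < y & sin y = cos z * y.
Proof.
move=> y0; have [|z zy] := @MVT R sin cos 0 y y0 (fun x _ => is_derive_sin x).
  exact/continuous_subspaceT/continuous_sin.
by rewrite in_itv/= in zy; rewrite sin0 !subr0 => ->; exists z.
Qed.

Lemma ler_norm_sin (R : realType) (y : R) : `|sin y| <= `|y|.
Proof.
wlog y0 : y / 0 < y.
  move=> h; have [y0|y0|<-] := ltgtP 0 y; first exact: h.
    by rewrite -normrN -sinN -[leRHS]normrN h// oppr_gt0.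
  by rewrite sin0.
have [z _ ->] := sin_mvt y0.
by rewrite normrM ler_piMl// cos_max.
Qed.

(** Halving the angle brings it into [0, pi/4], where the mean value theorem
    bounds sin (y/2) below by cos (pi/4) y/2; the remaining factor cos (y/2) is
    at least cos (pi/4) too, and the square of cos (pi/4) is 1/2. *)
Lemma ler_half_sin (R : realType) (y : R) : 0 <= y <= pi / 2 ->
  y / 2 <= sin y.
Proof.
move=> /andP[]; rewrite le_eqVlt => /predU1P[<- _|y0 ypi].
  by rewrite mul0r sin0.
pose w := y / 2; have w0 : 0 < w by rewrite divr_gt0.
have wpi : w <= pi / 4 by rewrite /w; lra.
have pi0 := pi_gt0 R.
have cosle z : 0 <= z <= w -> cos (pi / 4) <= cos z.
  move=> /andP[z0 zw].
  have [->//|zpi] := eqVneq z (pi / 4).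
  have {}zpi : z < pi / 4 by rewrite lt_neqAle zpi (le_trans zw).
  by apply/ltW; rewrite ltr_cos// in_itv/=; lra.
have cos4 : cos (pi / 4) ^+ 2 = 1 / 2 :> R.
  have := cos_pihalf R; rewrite (_ : pi / 2 = (pi / 4) *+ 2 :> R); last first.
    by rewrite [RHS]mulr2n; lra.
  rewrite cos_mulr2n [X in X - 1]mulr2n; lra.
have cos40 : 0 <= cos (pi / 4) :> R.
  by apply: cos_ge0_pihalf; apply/andP; split; lra.
have [z /andP[z0 zw] sw] := sin_mvt w0.
have -> : y = w *+ 2 by rewrite [RHS]mulr2n /w; lra.
rewrite sin_mulr2n sw.
have cz := cosle z; have cw := cosle w.
have {}cz : cos (pi / 4) <= cos z by apply: cz; rewrite (ltW z0) ltW.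
have {}cw : cos (pi / 4) <= cos w by apply: cw; rewrite (ltW w0) lexx.
have : cos (pi / 4) ^+ 2 <= cos w * cos z by rewrite expr2 ler_pM.
rewrite cos4 [X in _ -> _ <= X]mulr2n => h.
have : 1 / 2 * w <= cos w * cos z * w by rewrite ler_pM2r.
by rewrite (mulrA (cos w)); lra.
Qed.

Lemma norm_sinDpi_int (R : realType) (y : R) (m : int) :
  `|sin (y - m%:~R * pi)| = `|sin y|.
Proof.
have nat_case (n : nat) x : `|sin (x + n%:R * pi)| = `|sin x|.
  elim: n => [|n <-]; first by rewrite mul0r addr0.
  by rewrite -natr1 mulrDl mul1r addrA (sinDpi (x + _)) normrN.
case: m => n.
  by rewrite -[in RHS](subrK (n%:R * pi) y) nat_case.
by rewrite NegzE mulrNz mulNr opprK nat_case.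
Qed.

(** Near a zero of sin, the distance to that zero is controlled by [|sin|].
    The second bound, a consequence of pi >= 2, serves to count the zeros that
    a bounded range of [y] can meet. *)
Lemma near_multiple_pi (R : realType) (y d : R) : `|sin y| <= d ->
  exists2 m : int, `|y - m%:~R * pi| <= 2 * d & `|m%:~R| * 2 <= `|y| + 1.
Proof.
move=> yd; have pi0 := pi_gt0 R; have pi2 := pi_ge2 R.
(* the integer nearest to y / pi *)
pose m := Num.floor (y / pi + 1 / 2); exists m.
  have /andP[m1 m2] := floor_itv (y / pi + 1 / 2).
  rewrite -/m intrD in m1 m2.
  pose z := y - m%:~R * pi.
  have ypi : y = y / pi * pi by rewrite divfK// gt_eqF.
  have zpi : - (pi / 2) <= z <= pi / 2.
    have h1 : m%:~R * pi <= (y / pi + 1 / 2) * pi by rewrite ler_pM2r.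
    have h2 : (y / pi + 1 / 2) * pi <= (m%:~R + 1) * pi.
      by rewrite ler_pM2r// ltW.
    by rewrite mulrDl -ypi in h1 h2; apply/andP; split; rewrite /z; lra.
  have {}yd : `|sin z| <= d by rewrite norm_sinDpi_int.
  rewrite -/z; have [z0|z0] := leP 0 z.
    have := @ler_half_sin R z; rewrite z0 /= => /(_ (andP zpi).2).
    by move=> /le_trans /(_ (ler_norm _)) /le_trans /(_ yd);
      rewrite ger0_norm//; lra.
  have /andP[zpi1 zpi2] := zpi.
  have := @ler_half_sin R (- z); rewrite sinN => H.
  have {}H : - z / 2 <= - sin z by apply: H; apply/andP; split; lra.
  have : - z / 2 <= d.
    by rewrite (le_trans H)// (le_trans (ler_norm _))// normrN.
  by rewrite ltr0_norm//; lra.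
have /andP[m1 m2] := floor_itv (y / pi + 1 / 2).
rewrite -/m intrD in m1 m2.
have h : `|y / pi| * 2 <= `|y|.
  rewrite normrM normfV (gtr0_norm pi0) mulrAC ler_pdivrMr//.
  by rewrite ler_wpM2l.
have h1 := ler_norm (y / pi); have h2 := ler_norm (- (y / pi)).
rewrite normrN in h2.
case: (leP 0 m) => m0.
  rewrite ger0_norm ?ler0z//; lra.
have : m%:~R <= -1 :> R by rewrite -[-1]/((-1)%:~R) ler_int; move: m0; lia.
rewrite ltr0_norm ?ltrz0//; lra.
Qed.

(** * The measure of near resonances at a fixed time *)

Lemma measurable_sin (R : realType) : measurable_fun [set: R] (@sin R).
Proof. by apply: continuous_measurable_fun; exact: continuous_sin. Qed.

Lemma measurable_near_resonance1 (R : realType) (M t x d : R) :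
  measurable [set u : measurableTypeR R |
    `|u| <= M /\ `|sin (t * (u - x))| <= d].
Proof.
have m1 : measurable (setT `&` [set u : measurableTypeR R | `|u| <= M]).
  by apply: measurable_fun_le.
have m2 : measurable (setT `&` [set u : measurableTypeR R |
   `|sin (t * (u - x))| <= d]).
  apply: measurable_fun_le => //; apply: measurableT_comp => //.
  apply: (measurableT_comp (@measurable_sin R)).
  apply: measurable_funM => //; exact: measurable_funB.
rewrite !setTI in m1 m2; exact: measurableI.
Qed.

(** The set is covered by intervals of length 4d/t around the zeros of
    u |-> sin (t (u - x)), spaced by pi/t.  The number of those that meet
    [-M, M] is O(t) because t >= 1, so the factors t cancel and the bound is
    uniform in t and x. *)
Lemma lebesgue_near_resonance1 (R : realType) (M t x d : R) :
    0 <= M -> 1 <= t -> `|x| <= M -> 0 <= d ->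
  (@lebesgue_measure R
     [set u | `|u| <= M /\ `|sin (t * (u - x))| <= d]%R
   <= ((8 * M + 12) * d)%:E)%E.
Proof.
move=> M0 t1 xM d0; have t0 : 0 < t by apply: lt_le_trans t1.
(* zeros with index m, |m| <= L, are enough; they are listed by j = m + L *)
pose L := Num.truncn (M * t + 1).
have MtL : (L%:R <= M * t + 1) by rewrite truncn_le; nra.
pose c (j : nat) := x + (j%:R - L%:R) * pi / t.
pose A (j : nat) : set R := [set` `[c j - 2 * d / t, c j + 2 * d / t]].
have mA j : measurable (A j : set (measurableTypeR R)) by exact: measurable_itv.
have sub : [set u | `|u| <= M /\ `|sin (t * (u - x))| <= d] `<=`
    \big[setU/set0]_(j < (2 * L).+1) A j.
  move=> u /= [uM /near_multiple_pi[m hm mb]].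
  have mL : `|m%:~R| <= L%:R :> R.
    have ux : `|t * (u - x)| <= 2 * (M * t).
      rewrite normrM (gtr0_norm t0).
      have := ler_normB u x; nra.
    have -> : `|m%:~R| = `|m|%N%:R :> R by rewrite -intr_norm -abszE.
    rewrite ler_nat truncn_ge_nat; last by nra.
    have -> : `|m|%N%:R = `|m%:~R| :> R by rewrite -intr_norm -abszE.
    by lra.
  have {}mL : (`|m| <= L%:Z)%R.
    by move: mL; rewrite -intr_norm -(ler_int R).
  rewrite -bigcup_mkord; exists `|(m + L%:Z)%R|%N => /=.
    by move: mL; lia.
  have jE : (`|(m + L%:Z)%R|%N)%:R = m%:~R + L%:R :> R.
    rewrite -[LHS]/((`|(m + L%:Z)%R|%N)%:~R) abszE ger0_norm ?intrD//.
    by move: mL; lia.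
  rewrite /A /= in_itv /= /c jE addrK.
  move: hm; rewrite ler_norml => /andP[h1 h2].
  have -> : u = x + t * (u - x) / t.
    by rewrite mulrAC divff ?mul1r ?gt_eqF// addrC subrK.
  apply/andP; split.
    by rewrite -addrA lerD2l -mulrBl ler_pM2r ?invr_gt0//; lra.
  by rewrite -addrA lerD2l -mulrDl ler_pM2r ?invr_gt0//; lra.
apply: (@le_trans _ _
  (lebesgue_measure (\big[setU/set0]_(j < (2 * L).+1) A j))).
  apply: le_measure => //; rewrite inE; first exact: measurable_near_resonance1.
  exact: bigsetU_measurable.
apply: le_trans (Boole_inequality _ _) _ => //.
have lA j : lebesgue_measure (A j) = (4 * d / t)%:E.
  rewrite /A lebesgue_measure_itv /= lte_fin.
  case: ltP => [_|h]; first by rewrite -EFinD; congr EFin; lra.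
  congr EFin; have : 0 <= d / t by rewrite divr_ge0// ltW.
  by move: h; lra.
rewrite (eq_bigr (fun=> (4 * d / t)%:E)); last by move=> j _; exact: lA.
rewrite sumEFin lee_fin sumr_const card_ord -[leLHS]mulr_natl.
have -> : (8 * M + 12) * d = ((2 * M + 3) * t) * (4 * d / t).
  by field; rewrite gt_eqF.
apply: ler_wpM2r; first by rewrite divr_ge0 ?mulr_ge0// ltW.
by rewrite -natr1 natrM; nra.
Qed.

(** The index [i = 0] is included so that the base point is confined to
    [-M, M] too. *)
Definition near_resonance {R : realType} n (M t d : R) :
    set (n.+1.-tuple (measurableTypeR R)) :=
  [set U | forall i, `|tnth U i| <= M /\
                     `|sin (t * (tnth U i - tnth U ord0))| <= d].

Arguments near_resonance {R} n M t d.

Lemma measurable_near_resonance (R : realType) n (M t d : R) :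
  measurable (@near_resonance R n M t d).
Proof.
rewrite (_ : near_resonance _ _ _ _ = \bigcap_(i in [set: 'I_n.+1])
   ((setT `&` [set U : n.+1.-tuple (measurableTypeR R) | `|tnth U i| <= M]) `&`
   (setT `&` [set U : n.+1.-tuple (measurableTypeR R) |
     `|sin (t * (tnth U i - tnth U ord0))| <= d]))); last first.
  by apply/seteqP; split => [U UM i _|U UM i];
    [have [] := UM i | have [[_ ?] [_ ?]] := UM i I].
apply: fin_bigcap_measurable => // i _; apply: measurableI.
  apply: measurable_fun_le => //; apply: measurableT_comp => //.
  exact: measurable_tnth.
apply: measurable_fun_le => //; apply: measurableT_comp => //.
apply: (measurableT_comp (@measurable_sin R)); apply: measurable_funM => //.
by apply: measurable_funB; exact: measurable_tnth.
Qed.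

(** Once the base point x is fixed, the n remaining coordinates range in
    a product of copies of one set, of measure O(d): this gives the n-th power.
    The factor 2M comes from integrating over x. *)
Lemma lebesgue_near_resonance (R : realType) n (M t d : R) :
    0 <= M -> 1 <= t -> 0 <= d ->
  (lebesgue_measure_tuple n.+1 (near_resonance n M t d)
   <= (((8 * M + 12) * d) ^+ n * (2 * M))%:E)%E.
Proof.
move=> M0 t1 d0; rewrite /= /lebesgue_cons /pushforward.
set S := _ @^-1` _.
have mS : measurable S.
  rewrite -[X in measurable X]setTI; apply: measurable_cons_pair => //.
  exact: measurable_near_resonance.
pose K := ((8 * M + 12) * d) ^+ n.
have K0 : 0 <= K by rewrite exprn_ge0// mulr_ge0//; nra.
pose I : set (measurableTypeR R) := [set` `[-M, M]].
have mI : measurable I by exact: measurable_itv.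
apply: (@le_trans _ _ (\int[@lebesgue_measure R]_x (K%:E * (\1_I x)%:E))%E).
  apply: ge0_le_integral => //.
  - exact: measurable_fun_xsection.
  - by apply: measurable_funeM; apply/measurable_EFinP; exact: measurable_indic.
  move=> x _ /=; rewrite indicE; have [xI|xI] := boolP (x \in I).
    rewrite mule1; rewrite inE /I/= in_itv/= -ler_norml in xI.
    pose B := [set u : measurableTypeR R |
      `|u| <= M /\ `|sin (t * (u - x))| <= d].
    have mB : measurable B by exact: measurable_near_resonance1.
    apply: (@le_trans _ _ (lebesgue_measure_tuple n
       [set v | forall i, B (tnth v i)])).
      apply: le_measure.
      - by rewrite inE; exact: measurable_xsection.
      - rewrite inE (_ : [set v | _] = \bigcap_(i in [set: 'I_n])
          (setT `&`
            (fun v : n.-tuple (measurableTypeR R) => tnth v i) @^-1` B)).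
          apply: fin_bigcap_measurable => // i _.
          by apply: measurable_tnth.
        apply/seteqP; split => [v vB i _|v vB i].
          by rewrite setTI; exact: vB.
        by have := vB i Logic.I; rewrite setTI.
      move=> v; rewrite /xsection/= inE /S/= => xv i.
      by have := xv (lift ord0 i); rewrite tnthS.
    rewrite (@lebesgue_measure_tuple_box R n (fun=> B))//.
    apply: (@le_trans _ _ (\prod_(i < n) (((8 * M + 12) * d)%:E))%E).
      have := @lebesgue_near_resonance1 R M t x d M0 t1 xI d0.
      rewrite -/B.
      have : (0 <= lebesgue_measure B)%E by exact: measure_ge0.
      move: (lebesgue_measure B) => c c0 cle.
      elim: (index_enum _) => [|i s ih]; rewrite ?big_nil//.
      rewrite !big_cons; apply: lee_pmul => //.
      apply: (big_ind (fun z => (0 <= z)%E)) => //.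
      by move=> a b; exact: mule_ge0.
    by rewrite prodEFin prodr_const card_ord.
  rewrite (_ : xsection S x = set0) ?measure0 ?mule0//.
  apply/seteqP; split => // v; rewrite /xsection/= inE => /(_ ord0)[xM _].
  by move/negP : xI; apply; rewrite inE /I/= in_itv/= -ler_norml.
rewrite ge0_integralZl//; last first.
  by apply/measurable_EFinP; exact: measurable_indic.
have lI : (@lebesgue_measure R I <= (2 * M)%:E)%E.
  rewrite /I lebesgue_measure_itv /= lte_fin; case: ltP => _.
    by rewrite -EFinD lee_fin; lra.
  by rewrite lee_fin mulr_ge0.
rewrite integral_indic// setIT [leRHS]EFinM.
by apply: lee_pmul => //; rewrite lee_fin.
Qed.

(** * The characteristic function of a discrete measure *)

Lemma Rintegral_discrete (R : realType) n (c : 'I_n.+1 -> R)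
    (U : n.+1.-tuple (measurableTypeR R))
    (mu : probability (measurableTypeR R) R) (f : R -> R) :
  (forall i, 0 <= c i) ->
  (forall A : set (measurableTypeR R), measurable A ->
     mu A = (\sum_(i < n.+1) (c i)%:E * \d_(tnth U i) A)%E) ->
  measurable_fun [set: measurableTypeR R] f ->
  \int[mu]_x f x = \sum_(i < n.+1) c i * f (tnth U i).
Proof.
move=> c0 muE mf.
pose m_ (k : nat) : {measure set (measurableTypeR R) -> \bar R} :=
  mscale (NngNum (c0 (inord k))) (\d_(tnth U (inord k))).
have nnE (g : measurableTypeR R -> \bar R) : (forall x, (0 <= g x)%E) ->
    measurable_fun setT g ->
    (\int[mu]_x g x = \sum_(i < n.+1) (c i)%:E * g (tnth U i))%E.
  move=> g0 mg.
  rewrite (@eq_measure_integral _ _ _ _ (msum m_ n.+1)); last first.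
    move=> A mA _; rewrite [LHS]muE//.
    by apply: eq_bigr => i _; rewrite /m_ /mscale /= inord_val.
  rewrite ge0_integral_measure_sum//; apply: eq_bigr => i _.
  rewrite /m_ ge0_integral_mscale// integral_dirac// diracT mul1e.
  by rewrite /= inord_val.
have mEf : measurable_fun [set: measurableTypeR R] (EFin \o f).
  exact/measurable_EFinP.
rewrite /Rintegral integralE nnE//; last exact: measurable_funepos.
rewrite nnE//; last exact: measurable_funeneg.
have -> : (\sum_(i < n.+1) (c i)%:E * ((EFin \o f)^\+ (tnth U i)) =
    (\sum_(i < n.+1) c i * Num.max (f (tnth U i)) 0)%:E)%E.
  by rewrite -sumEFin; apply: eq_bigr => i _;
    rewrite EFinM EFin_max ?funeposE ?funenegE.
have -> : (\sum_(i < n.+1) (c i)%:E * ((EFin \o f)^\- (tnth U i)) =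
    (\sum_(i < n.+1) c i * Num.max (- f (tnth U i)) 0)%:E)%E.
  by rewrite -sumEFin; apply: eq_bigr => i _;
    rewrite EFinM EFin_max ?funeposE ?funenegE.
rewrite -EFinB /= -sumrB; apply: eq_bigr => i _.
rewrite -mulrBr; congr (_ * _).
by case: (leP (f (tnth U i)) 0); case: (leP (- f (tnth U i)) 0); lra.
Qed.

Lemma sum_sqr_cos_sin (R : realType) (I : finType) (c x : I -> R) :
  (\sum_i c i) ^+ 2 - (\sum_i c i * cos (x i)) ^+ 2
    - (\sum_i c i * sin (x i)) ^+ 2
  = \sum_i \sum_j c i * c j * (1 - cos (x i - x j)).
Proof.
rewrite !expr2 !big_distrlr/= -!sumrB; apply: eq_bigr => i _.
rewrite -!sumrB; apply: eq_bigr => j _.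
by rewrite cosB; ring.
Qed.

(** The double sum of [sum_sqr_cos_sin] has nonnegative terms; it is bounded
    below by the single term with indices i, j. *)
Lemma sqr_modulus_discrete (R : realType) (I : finType) (c x : I -> R) i j :
  (forall k, 0 <= c k) -> \sum_k c k = 1 ->
  (\sum_k c k * cos (x k)) ^+ 2 + (\sum_k c k * sin (x k)) ^+ 2
  <= 1 - 2 * (c i * c j) * sin ((x i - x j) / 2) ^+ 2.
Proof.
move=> c0 c1; have := sum_sqr_cos_sin c x; rewrite c1 expr1n => E.
have P k l : 0 <= c k * c l * (1 - cos (x k - x l)).
  by rewrite !mulr_ge0// subr_ge0 cos_le1.
have cosE : 1 - cos (x i - x j) = 2 * sin ((x i - x j) / 2) ^+ 2.
  have {1}-> : x i - x j = ((x i - x j) / 2) *+ 2 by rewrite [RHS]mulr2n; lra.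
  rewrite cos_mulr2n cos2sin2 [X in 1 - (X - 1)]mulr2n; lra.
have : c i * c j * (1 - cos (x i - x j)) <=
    \sum_k \sum_l c k * c l * (1 - cos (x k - x l)).
  rewrite (bigD1 i)//= (bigD1 j)//= -addrA lerDl addr_ge0//.
    by apply: sumr_ge0.
  by apply: sumr_ge0 => k _; apply: sumr_ge0.
rewrite -E cosE; lra.
Qed.

Lemma norm_characteristic_function_discrete (R : realType) n (c : 'I_n.+1 -> R)
    (U : n.+1.-tuple (measurableTypeR R))
    (mu : probability (measurableTypeR R) R) (i j : 'I_n.+1) (t : R) :
  (forall i, 0 <= c i) -> \sum_(i < n.+1) c i = 1 ->
  (forall A : set (measurableTypeR R), measurable A ->
     mu A = (\sum_(i < n.+1) (c i)%:E * \d_(tnth U i) A)%E) ->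
  `|characteristic_function mu t| <=
    (1 - c i * c j * sin (t / 2 * (tnth U i - tnth U j)) ^+ 2)%:C%C.
Proof.
move=> c0 c1 muE.
have mt : measurable_fun [set: measurableTypeR R] (fun x : R => t * x).
  exact: measurable_funM.
have mcos : measurable_fun [set: measurableTypeR R] (fun x : R => cos (t * x)).
  apply: (@measurableT_comp _ _ _ _ _ _ (@cos R)) => //.
  by apply: continuous_measurable_fun; exact: continuous_cos.
have msin : measurable_fun [set: measurableTypeR R] (fun x : R => sin (t * x)).
  by apply: (measurableT_comp (@measurable_sin R)).
rewrite normc_def lecR /characteristic_function /complex_integral /=.
rewrite (Rintegral_discrete c0 muE mcos) (Rintegral_discrete c0 muE msin).
have := sqr_modulus_discrete (fun k => t * tnth U k) i j c0 c1.
have -> : (t * tnth U i - t * tnth U j) / 2 = t / 2 * (tnth U i - tnth U j).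
  by field.
rewrite -mulrA; set m := _ ^+ 2 + _ ^+ 2; set s := c i * c j * _ => h.
have m0 : 0 <= m by rewrite addr_ge0 ?sqr_ge0.
(* from m <= 1 - 2 s: 0 <= m forces s <= 1/2, and 1 - 2 s <= (1 - s)^2 *)
rewrite -(@ler_pXn2r _ 2) ?nnegrE ?sqrtr_ge0//; last lra.
by rewrite sqr_sqrtr//; nra.
Qed.

(** * Dyadic blocks of times *)

(** An integer between (2^n)^b and (2^n)^b + 1; it is positive, which allows
    dividing by it. *)
Definition grid_size {R : realType} (b : R) (n : nat) : nat :=
  (Num.truncn ((2 ^+ n) `^ b)).+1.

(** Resonance at some point of the grid of step 1/N in the block
    [2^n, 2^(n+1)), where N = [grid_size b n].  The quality 1/N is relaxed to
    (1 + 2M)/N to absorb the rounding of the time to the grid. *)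
Definition grid_resonance {R : realType} k (b M : R) (n : nat) :
    set (k.+1.-tuple (measurableTypeR R)) :=
  \big[setU/set0]_(j < 2 ^ n * grid_size b n)
    near_resonance k M (2 ^+ n + j%:R / (grid_size b n)%:R)
      ((1 + 2 * M) / (grid_size b n)%:R).

Arguments grid_resonance {R} k b M n.

Lemma measurable_grid_resonance (R : realType) k (b M : R) n :
  measurable (grid_resonance k b M n).
Proof.
by apply: bigsetU_measurable => j _; exact: measurable_near_resonance.
Qed.

Lemma grid_size_gt (R : realType) (b : R) n :
  (2 ^+ n) `^ b < (grid_size b n)%:R.
Proof. exact: truncnS_gt. Qed.

Lemma grid_size_gt0 (R : realType) (b : R) n : 0 < (grid_size b n)%:R :> R.
Proof. by rewrite ltr0n. Qed.

(** There are 2^n N grid points, each contributing O(N^-(k+1)); the total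
    O(2^n N^-k) is geometric in n because N >= (2^b)^n. *)
Lemma lebesgue_grid_resonance (R : realType) k (b M : R) n : 0 <= M ->
  (lebesgue_measure_tuple k.+2 (grid_resonance k.+1 b M n)
   <= (((8 * M + 12) * (1 + 2 * M)) ^+ k.+1 * (2 * M)
       * (2 / (2 `^ b) ^+ k) ^+ n)%:E)%E.
Proof.
move=> M0; have N0 := grid_size_gt0 b n; have Nb := grid_size_gt b n.
rewrite /grid_resonance; move: (grid_size b n) N0 Nb => N N0 Nb.
set A := (8 * M + 12) * (1 + 2 * M).
have A0 : 0 <= A by rewrite /A; nra.
pose F (j : nat) : set (k.+2.-tuple (measurableTypeR R)) :=
  near_resonance k.+1 M (2 ^+ n + j%:R / N%:R) ((1 + 2 * M) / N%:R).
apply: (le_trans (@Boole_inequality _ _ _ (lebesgue_measure_tuple k.+2) F _ _)).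
  by move=> j _; exact: measurable_near_resonance.
apply: (@le_trans _ _
  (\sum_(j < 2 ^ n * N) ((A / N%:R) ^+ k.+1 * (2 * M))%:E)%E).
  apply: lee_sum => j _; rewrite /A -mulrA.
  apply: lebesgue_near_resonance => //.
    by rewrite (le_trans (exprn_ege1 n (ler1n R 2)))// lerDl divr_ge0.
  by rewrite divr_ge0//; nra.
rewrite sumEFin lee_fin sumr_const card_ord -[leLHS]mulr_natl natrM natrX.
rewrite expr_div_n (exprS N%:R).
have -> : 2 ^+ n * N%:R * (A ^+ k.+1 / (N%:R * N%:R ^+ k) * (2 * M)) =
    A ^+ k.+1 * (2 * M) * (2 ^+ n / N%:R ^+ k).
  by field; rewrite expf_neq0 gt_eqF.
apply: ler_wpM2l; first by rewrite mulr_ge0 ?exprn_ge0// mulr_ge0.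
rewrite expr_div_n; apply: ler_wpM2l; first exact: exprn_ge0.
have b0 : 0 < 2 `^ b by exact: powR_gt0.
rewrite lef_pV2 ?posrE ?exprn_gt0// -exprM mulnC exprM.
apply: lerXn2r; rewrite ?nnegrE ?exprn_ge0 ?(ltW N0) ?(ltW b0)//.
apply: le_trans (ltW Nb).
by rewrite -!powR_mulrn ?powR_ge0// powRAC.
Qed.

(** The hypothesis on b says that the ratio 2 / 2^(b k) is less than 1. *)
Lemma lim_sup_grid_resonance (R : realType) k (b M : R) : 0 <= M ->
  1 < b * k%:R ->
  lebesgue_measure_tuple k.+2 (lim_sup_set (grid_resonance k.+1 b M)) = 0%E.
Proof.
move=> M0 bk; apply: lim_sup_set_cvg0.
  by move=> n; exact: measurable_grid_resonance.
pose A : R := ((8 * M + 12) * (1 + 2 * M)) ^+ k.+1 * (2 * M).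
pose r : R := 2 / (2 `^ b) ^+ k.
have A0 : 0 <= A by rewrite /A mulr_ge0 ?exprn_ge0//; nra.
have r0 : 0 < r by rewrite divr_gt0// exprn_gt0// powR_gt0.
have r1 : r < 1.
  rewrite /r ltr_pdivrMr ?exprn_gt0 ?powR_gt0// mul1r.
  rewrite -powR_mulrn ?powR_ge0// -powRrM -[ltLHS]powRr1//.
  by rewrite /powR gt_eqF// ltr_expR ltr_pM2r// ln_gt0 ?ltr1n.
apply: (@le_lt_trans _ _ (A * (1 - r)^-1)%:E); last exact: ltry.
apply: lime_le; first by apply: is_cvg_nneseries => n _ _; exact: measure_ge0.
apply: nearW => n.
apply: (@le_trans _ _ (\sum_(0 <= i < n) (A * r ^+ i)%:E)%E).
  by apply: lee_sum => i _; exact: lebesgue_grid_resonance.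
rewrite sumEFin lee_fin; apply: (geometric_le_lim n A0 r0).
by rewrite gtr0_norm.
Qed.

(** Rounding t down to the grid moves it by at most 1/N, and this changes
    sin (t x), for |x| <= 2M, by at most 2M/N. *)
Lemma grid_resonance_cover (R : realType) k (b M t : R) n
    (U : k.+1.-tuple (measurableTypeR R)) :
  (forall i, `|tnth U i| <= M) -> 2 ^+ n <= t < 2 ^+ n.+1 ->
  (forall i, `|sin (t * (tnth U i - tnth U ord0))| <= (grid_size b n)%:R^-1) ->
  grid_resonance k b M n U.
Proof.
move=> UM /andP[nt tn] Ut; have N0 := grid_size_gt0 b n.
rewrite /grid_resonance; move: (grid_size b n) N0 Ut => N N0 Ut.
pose j := Num.truncn ((t - 2 ^+ n) * N%:R).
have tN0 : 0 <= (t - 2 ^+ n) * N%:R by rewrite mulr_ge0 ?subr_ge0.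
have /andP[j1 j2] := truncn_itv tN0.
rewrite -/j -[j.+1]addn1 natrD in j1 j2.
rewrite -(bigcup_mkord _
  (fun j => near_resonance k M (2 ^+ n + j%:R / N%:R) _)).
exists j => /=.
  rewrite truncn_lt_nat// natrM natrX ltr_pM2r//.
  by move: tn; rewrite exprS; lra.
move=> i; split; first exact: UM.
set x := tnth U i - tnth U ord0.
have xM : `|x| <= 2 * M.
  rewrite /x (le_trans (ler_normB _ _))//.
  by have := UM i; have := UM ord0; lra.
pose e := t - (2 ^+ n + j%:R / N%:R).
have eE : e * N%:R = (t - 2 ^+ n) * N%:R - j%:R.
  by rewrite /e; field; rewrite gt_eqF.
have e0 : 0 <= e by rewrite -(pmulr_lge0 _ N0) eE subr_ge0.
have e1 : e <= N%:R^-1 by rewrite -(ler_pM2r N0) eE mulVf ?gt_eqF//; lra.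
have -> : (2 ^+ n + j%:R / N%:R) * x = t * x - e * x by rewrite /e; ring.
rewrite sinB (le_trans (ler_normB _ _))// !normrM [leRHS]mulrDl mul1r lerD//.
  by rewrite (le_trans _ (Ut i))// ler_piMr// cos_max.
rewrite (le_trans (ler_piMl _ (cos_max _)))//.
rewrite (le_trans (ler_norm_sin _))// normrM (ger0_norm e0) mulrC.
by rewrite ler_pM.
Qed.

Lemma grid_size_le (R : realType) (b t : R) n : 0 <= b -> 2 ^+ n <= t ->
  (grid_size b n)%:R <= 2 * t `^ b.
Proof.
move=> b0 nt; have n1 : 1 <= 2 ^+ n :> R by rewrite exprn_ege1// ler1n.
have t1 : 1 <= t `^ b.
  by rewrite -[leLHS](powRr0 t) ler_powR// (le_trans n1).
rewrite /grid_size -natr1 [leRHS]mulr_natl [leRHS]mulr2n lerD//.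
rewrite (@le_trans _ _ ((2 ^+ n) `^ b))// ?truncn_le ?powR_ge0//.
have t0 : 0 <= t by rewrite (le_trans _ nt)// exprn_ge0.
by apply: ge0_ler_powR; rewrite // nnegrE ?exprn_ge0.
Qed.

(** * Almost every configuration is nonresonant *)

(** Beyond some block there is no resonance: for large t, some index i has
    |sin (t/2 (U_i - U_0))| > 1/N >= 1 / (2 |t|^b).  The index depends on t,
    hence the uniform lower bound a on the weights. *)
Lemma weak_cramer_of_nonresonant (R : realType) k (b M : R)
    (U : k.+1.-tuple (measurableTypeR R)) : 0 <= b ->
  (forall i, `|tnth U i| <= M) -> ~ lim_sup_set (grid_resonance k b M) U ->
  discrete_measures U `<=` weak_cramer (2 * b).
Proof.
move=> b0 UM NU mu [c [c0 c1 muE]].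
have [n0 n0P] : exists n0, forall n, (n0 <= n)%N ->
    ~ grid_resonance k b M n U.
  apply: contrapT => /forallNP H; apply: NU => n _.
  apply: contrapT => H'; apply: (H n) => m nm Um; apply: H'; by exists m.
have [a a0 ac] : exists2 a : R, 0 < a & forall i, a <= c i.
  exists (\big[Num.min/1]_i c i); last by move=> i; exact: bigmin_le_cond.
  by rewrite lt_bigmin.
exists (a ^+ 2 / 4), (2 ^+ n0.+1); split.
- by rewrite divr_gt0// exprn_gt0.
- by rewrite exprn_gt0.
move=> t tT; pose s := `|t| / 2.
have sT : 2 ^+ n0 < s by rewrite /s; move: tT; rewrite exprS; lra.
have s1 : 1 <= s by rewrite (le_trans _ (ltW sT))// exprn_ege1// ler1n.
have s0 : 0 <= s by rewrite (le_trans _ s1).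
pose n := trunc_log 2 (Num.truncn s).
have ns : 2 ^+ n <= s.
  rewrite -natrX -truncn_ge_nat//; apply: trunc_logP => //.
  by rewrite truncn_gt0.
have sn : s < 2 ^+ n.+1.
  by rewrite -natrX -truncn_lt_nat//; exact: trunc_log_ltn.
have n0n : (n0 <= n)%N.
  apply: trunc_log_max => //; rewrite truncn_ge_nat// natrX; exact: ltW.
have [i hi] : exists i, (grid_size b n)%:R^-1 <
    `|sin (s * (tnth U i - tnth U ord0))|.
  apply: contrapT => /forallNP H; apply: (n0P n n0n).
  apply: (@grid_resonance_cover _ _ _ _ s) => //; first by rewrite ns.
  by move=> i; rewrite leNgt; apply/negP; exact: H.
have c0' j : 0 <= c j by exact/ltW.
apply: le_trans (norm_characteristic_function_discrete i ord0 t c0' c1 muE) _.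
rewrite lecR lerD2l lerN2.
have -> : sin (t / 2 * (tnth U i - tnth U ord0)) ^+ 2 =
    `|sin (s * (tnth U i - tnth U ord0))| ^+ 2.
  rewrite real_normK ?num_real// /s; have [t0|t0] := leP 0 t.
    by rewrite ger0_norm.
  by rewrite ltr0_norm// !mulNr sinN sqrrN.
have N0 := grid_size_gt0 b n.
have s2 : s <= `|t| by rewrite /s; have := normr_ge0 t; lra.
have Nt := grid_size_le b0 (le_trans ns s2).
have t0 : 0 < `|t| `^ b.
  by rewrite powR_gt0// (lt_le_trans _ s2)// (lt_le_trans _ s1).
rewrite (mulrC 2 b) powRrM powR_mulrn ?powR_ge0//.
have -> : a ^+ 2 / 4 / (`|t| `^ b) ^+ 2 = (a * a) * ((2 * `|t| `^ b)^-1) ^+ 2.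
  by field; rewrite gt_eqF.
apply: ler_pM.
- by rewrite mulr_ge0 // ltW.
- by rewrite sqr_ge0.
- by rewrite ler_pM// ltW.
rewrite lerXn2r ?nnegrE ?invr_ge0 ?mulr_ge0 ?(ltW t0)//.
by rewrite (le_trans _ (ltW hi))// lef_pV2 ?posrE ?mulr_gt0.
Qed.

Theorem proposition2p1 (R : realType) (p : nat) (hp : (3 <= p)%N)
  (b : R) (hb : 1 / (p%:R - 2) < b) :
  (lebesgue_measure_tuple p).-negligible
    [set U : p.-tuple (measurableTypeR R) |
      ~ (discrete_measures U `<=` weak_cramer (2 * b))].
Proof.
case: p hp hb => [|[|[|k]]]// _.
have -> : k.+3%:R - 2 = k.+1%:R :> R by rewrite -addn2 natrD addrK.
rewrite ltr_pdivrMr// => bk.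
have b0 : 0 <= b.
  by rewrite leNgt; apply/negP => b0; have := ltr0Sn R k; nra.
pose F (m : nat) : set (k.+3.-tuple (measurableTypeR R)) :=
  lim_sup_set (grid_resonance k.+2 b m%:R).
apply: (@negligibleS _ _ _ _ (\bigcup_m F m)); last first.
  apply: negligible_bigcup => m; apply/negligibleP.
    apply: bigcap_measurable => // n _; apply: bigcup_measurable => // j _.
    exact: measurable_grid_resonance.
  exact: lim_sup_grid_resonance.
move=> U /= HU; apply: contrapT => NF; apply: HU.
pose m := (Num.truncn (\sum_i `|tnth U i|)).+1.
apply: (@weak_cramer_of_nonresonant _ _ _ m%:R) => // [i|UF].
  rewrite (le_trans _ (ltW (truncnS_gt _)))//.
  by rewrite (bigD1 i)//= lerDl sumr_ge0.
by apply: NF; exists m.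
Qed.
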